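(* Suppose $(\Sigma_0,\beta_0)=(\Sigma,\beta)$ and $\Sigma=I$. Then the components of the deterministic risk equivalent $\mathscr R(\lambda,\phi)$ defined in the context have the following properties. (1) (Bias component) For all $\lambda>0$, $\mathscr B(\lambda,\phi)$ is strictly increasing over $\phi\in(0,\lambda+1)$ and strictly decreasing over $\phi\in(\lambda+1,\infty)$. (2) (Variance component) For all $\lambda>0$, $\mathscr V(\lambda,\phi)$ is strictly increasing over $\phi\in(0,\infty)$. (3) (Risk) When $\|\beta\|_2^2>0$, for all $\lambda>0$ and $\epsilon>0$, there exist $\sigma^2,\phi\in(0,\infty)$ such that $\partial\mathscr R(\lambda,\phi)/\partial\phi\le-\epsilon$, i.e., $$\max_{\sigma^2,\phi\in(0,\infty)}\ \min_{\lambda\ge\lambda_{\min}(\phi)}\ \frac{\partial\mathscr R(\lambda,\phi)}{\partial\phi}\le-\epsilon.$$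
   Context: Parameters: $\Sigma,\Sigma_0\in\mathbb R^{p\times p}$ are the feature covariances of the train and test distributions; $\beta,\beta_0\in\mathbb R^p$ are the coefficient vectors of the $L_2$ linear projections of the train and test responses on the features; $\sigma^2,\sigma_0^2$ are the corresponding noise (conditional response) variances; $\phi\in(0,\infty)$ is the limit of $p/n$, with $n$ the number of train samples and $p$ the number of features; $\lambda$ is the ridge penalty. Write $\overline{\mathrm{tr}}[A]=\mathrm{tr}[A]/p$ for $A\in\mathbb R^{p\times p}$, and let $r_{\min}$ be the smallest eigenvalue of $\Sigma$. Let $\mu_{\min}>-r_{\min}$ be the unique solution of $1=\phi\,\overline{\mathrm{tr}}[\Sigma^2(\Sigma+\mu_{\min}I)^{-2}]$ and $\lambda_{\min}(\phi)=\mu_{\min}-\phi\,\overline{\mathrm{tr}}[\mu_{\min}\Sigma(\Sigma+\mu_{\min}I)^{-1}]$. For $\lambda>\lambda_{\min}(\phi)$, let $\mu=\mu(\lambda,\phi)$ be the solution with $\mu>\mu_{\min}$ of $\mu=\lambda+\phi\,\overline{\mathrm{tr}}[\mu\Sigma(\Sigma+\mu I)^{-1}]$, and $$\tilde v=\tilde v(\lambda,\phi)=\frac{\phi\,\overline{\mathrm{tr}}[\Sigma_0\Sigma(\Sigma+\mu I)^{-2}]}{1-\phi\,\overline{\mathrm{tr}}[\Sigma^2(\Sigma+\mu I)^{-2}]}.$$ The deterministic equivalent of the prediction risk of ridge regression with penalty $\lambda$ is $\mathscr R(\lambda,\phi)=\mathscr B(\lambda,\phi)+\mathscr V(\lambda,\phi)+\mathscr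 S(\lambda,\phi)+\kappa^2$, where $\mathscr B=\mu^2\beta^\top(\Sigma+\mu I)^{-1}(\tilde v\Sigma+\Sigma_0)(\Sigma+\mu I)^{-1}\beta$ (bias), $\mathscr V=\sigma^2\tilde v$ (variance), $\mathscr S=2\mu\,\beta^\top(\Sigma+\mu I)^{-1}\Sigma_0(\beta_0-\beta)$ (regression shift bias, equal to $0$ here because $\beta_0=\beta$), and $\kappa^2=(\beta_0-\beta)^\top\Sigma_0(\beta_0-\beta)+\sigma_0^2$ (irreducible error, equal to $\sigma_0^2$ here).
   Formalization: Bias and variance are interchanged in (1)-(2), as the printed version is false: the bias increases on (0,∞), the variance increases up to λ+1 and then decreases. Assumes ‖β‖²>0 for the bias and σ²>0 for the variance; the max-min display after ''i.e.'' in (3), false if read literally, is omitted. *)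

(* Defs.v *)
(* Ridge risk deterministic equivalents, over an abstract realType
   (MathComp and MathComp-Analysis).
   Throughout, [p] is the number of features, [Sigma], [Sigma0] are the train
   and test covariances, [beta], [beta0] the train and test projection
   coefficients, [sigma2], [sigma02] the train and test noise variances
   (themselves, not their square roots), [lambda] the ridge penalty and [phi]
   the limit of the aspect ratio. *)
From mathcomp Require Import all_boot all_order all_algebra.
From mathcomp Require Import all_classical all_reals all_analysis.

Set Implicit Arguments.
Unset Strict Implicit.
Unset Printing Implicit Defensive.

Import Order.TTheory GRing.Theory Num.Theory.
Import numFieldNormedType.Exports.

Local Open Scope classical_set_scope.
Local Open Scope ring_scope.

Definition trbar (R : realType) (p : nat) (A : 'M[R]_p) : R := \tr A / p%:R.

Definition quad (R : realType) (p : nat) (u : 'cV[R]_p) (A : 'M[R]_p)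
    (v : 'cV[R]_p) : R :=
  (u^T *m A *m v) 0 0.

Definition sqnorm (R : realType) (p : nat) (u : 'cV[R]_p) : R :=
  \sum_(i < p) u i 0 ^+ 2.

(* A square matrix has finitely many eigenvalues, so the infimum is a minimum
   as soon as there is one (in particular when [Sigma] is symmetric and
   [0 < p]). *)
Definition r_min (R : realType) (p : nat) (Sigma : 'M[R]_p) : R :=
  inf [set r : R | eigenvalue Sigma r].

(* [invmx A = A] when [A] is singular; [Sigma + m I] is invertible for every
   [m > - r_min Sigma], which is the only range used below. *)
Definition resolvent (R : realType) (p : nat) (Sigma : 'M[R]_p) (m : R) :
    'M[R]_p :=
  invmx (Sigma + m%:M).

(* phi * trbar [A Sigma (Sigma + m I)^-2] *)
Definition phi_tr2 (R : realType) (p : nat) (A Sigma : 'M[R]_p) (phi m : R) :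
    R :=
  phi * trbar (A *m Sigma *m resolvent Sigma m *m resolvent Sigma m).

(* phi * trbar [m Sigma (Sigma + m I)^-1] *)
Definition phi_tr1 (R : realType) (p : nat) (Sigma : 'M[R]_p) (phi m : R) : R :=
  phi * trbar (m *: (Sigma *m resolvent Sigma m)).

Definition is_mu_min (R : realType) (p : nat) (Sigma : 'M[R]_p) (phi m : R) :
    Prop :=
  - r_min Sigma < m /\ 1 = phi_tr2 Sigma Sigma phi m.

(* [xget 0 P] is an element of [P], and [0] when [P] is empty. *)
Definition mu_min (R : realType) (p : nat) (Sigma : 'M[R]_p) (phi : R) : R :=
  xget 0 [set m : R | is_mu_min Sigma phi m].

Definition lambda_min (R : realType) (p : nat) (Sigma : 'M[R]_p) (phi : R) :
    R :=
  mu_min Sigma phi - phi_tr1 Sigma phi (mu_min Sigma phi).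

Definition is_mu (R : realType) (p : nat) (Sigma : 'M[R]_p) (lambda phi m : R) :
    Prop :=
  [/\ lambda_min Sigma phi < lambda, mu_min Sigma phi < m
    & m = lambda + phi_tr1 Sigma phi m].

Definition mu (R : realType) (p : nat) (Sigma : 'M[R]_p) (lambda phi : R) : R :=
  xget 0 [set m : R | is_mu Sigma lambda phi m].

Definition vtilde (R : realType) (p : nat) (Sigma Sigma0 : 'M[R]_p)
    (lambda phi : R) : R :=
  let m := mu Sigma lambda phi in
  phi_tr2 Sigma0 Sigma phi m / (1 - phi_tr2 Sigma Sigma phi m).

Definition risk_bias (R : realType) (p : nat) (Sigma Sigma0 : 'M[R]_p)
    (beta : 'cV[R]_p) (lambda phi : R) : R :=
  let m := mu Sigma lambda phi in
  let Q := resolvent Sigma m in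
  m ^+ 2 * quad beta
    (Q *m (vtilde Sigma Sigma0 lambda phi *: Sigma + Sigma0) *m Q) beta.

Definition risk_variance (R : realType) (p : nat) (Sigma Sigma0 : 'M[R]_p)
    (sigma2 lambda phi : R) : R :=
  sigma2 * vtilde Sigma Sigma0 lambda phi.

Definition risk_shift (R : realType) (p : nat) (Sigma Sigma0 : 'M[R]_p)
    (beta beta0 : 'cV[R]_p) (lambda phi : R) : R :=
  let m := mu Sigma lambda phi in
  2 * m * quad beta (resolvent Sigma m *m Sigma0) (beta0 - beta).

Definition irreducible_error (R : realType) (p : nat) (Sigma0 : 'M[R]_p)
    (beta beta0 : 'cV[R]_p) (sigma02 : R) : R :=
  quad (beta0 - beta) Sigma0 (beta0 - beta) + sigma02.

Definition risk (R : realType) (p : nat) (Sigma Sigma0 : 'M[R]_p)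
    (beta beta0 : 'cV[R]_p) (sigma2 sigma02 lambda phi : R) : R :=
  risk_bias Sigma Sigma0 beta lambda phi
  + risk_variance Sigma Sigma0 sigma2 lambda phi
  + risk_shift Sigma Sigma0 beta beta0 lambda phi
  + irreducible_error Sigma0 beta beta0 sigma02.

Definition increasing_on (R : realType) (I : interval R) (f : R -> R) : Prop :=
  {in I &, {homo f : x y / x < y}}.

Definition decreasing_on (R : realType) (I : interval R) (f : R -> R) : Prop :=
  {in I &, {homo f : x y /~ x < y}}.

(* Main.v *)
(* For [Sigma = 1] the fixed-point equation says
   [phi = (mu - lambda) * (1 + mu) / mu], so [mu] is the positive root of a
   quadratic and is strictly increasing in [phi]. Eliminating [phi] gives
     vtilde = (mu - lambda) / (mu^2 + lambda),
     bias = |beta|^2 * mu^3 / ((1 + mu) * (mu^2 + lambda)).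
   The second is increasing in [mu]. The first increases while
   [(mu - lambda)^2 < lambda^2 + lambda], i.e. while [phi < lambda + 1], and
   decreases afterwards. At [phi = lambda + 2] its derivative is thus negative,
   and a large [sigma2] makes it dominate the derivative of the bias. *)
Require Import Defs.
From mathcomp Require Import all_boot all_order all_algebra.
From mathcomp Require Import all_classical all_reals all_analysis.
From mathcomp Require Import ring lra.

Set Implicit Arguments.
Unset Strict Implicit.
Unset Printing Implicit Defensive.

Import Order.TTheory GRing.Theory Num.Theory.
Import numFieldNormedType.Exports.

Local Open Scope classical_set_scope.
Local Open Scope ring_scope.

Lemma sqrD_gt0 (R : realDomainType) (x a : R) : 0 < a -> 0 < x ^+ 2 + a.
Proof. by move=> a0; rewrite ltr_wpDl// sqr_ge0. Qed.

(** * Spectral quantities of the identity covariance *)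

Lemma r_min_id (R : realType) (p : nat) :
  (0 < p)%N -> r_min (1%:M : 'M[R]_p) = 1.
Proof.
move=> p0; rewrite /r_min (_ : [set r | _] = [set 1]) ?inf1//.
apply/seteqP; split=> [r /= /eigenvalueP[v]|r /= ->].
- rewrite mulmx1 => vE v0; have /eqP : (1 - r) *: v = 0.
    by rewrite scalerBl scale1r -vE subrr.
  by rewrite scaler_eq0 (negPf v0) orbF subr_eq0 => /eqP.
(* [0 < p] enters here: the constant vector is nonzero because it has at least one entry. *)
- apply/eigenvalueP; exists (const_mx 1); first by rewrite mulmx1 scale1r.
  by apply/eqP => /rowP/(_ (Ordinal p0))/eqP; rewrite !mxE oner_eq0.
Qed.

Lemma trbar_scalar (R : realType) (p : nat) (a : R) :
  (0 < p)%N -> trbar (a%:M : 'M[R]_p) = a.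
Proof.
move=> p0; rewrite /trbar mxtrace_scalar -[a *+ p]mulr_natr mulfK//.
by rewrite pnatr_eq0 -lt0n.
Qed.

Lemma resolvent_id (R : realType) (p : nat) (m : R) :
  resolvent (1%:M : 'M[R]_p) m = (1 + m)^-1%:M.
Proof. by rewrite /resolvent -raddfD/= invmx_scalar. Qed.

Lemma phi_tr2_id (R : realType) (p : nat) (phi m : R) : (0 < p)%N ->
  phi_tr2 (1%:M : 'M[R]_p) 1%:M phi m = phi * (1 + m)^-1 ^+ 2.
Proof.
move=> p0.
by rewrite /phi_tr2 resolvent_id !mul1mx -scalar_mxM trbar_scalar// expr2.
Qed.

Lemma phi_tr1_id (R : realType) (p : nat) (phi m : R) : (0 < p)%N ->
  phi_tr1 (1%:M : 'M[R]_p) phi m = phi * (m * (1 + m)^-1).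
Proof.
move=> p0.
by rewrite /phi_tr1 resolvent_id mul1mx scale_scalar_mx trbar_scalar.
Qed.

Lemma quad_scalar (R : realType) (p : nat) (u : 'cV[R]_p) (a : R) :
  quad u a%:M u = a * sqnorm u.
Proof.
rewrite /quad mul_mx_scalar -scalemxAl !mxE; congr (_ * _).
by apply: eq_bigr => i _; rewrite mxE expr2.
Qed.

(** The defining equation becomes [phi = (1 + m) ^+ 2], and [- r_min < m] says [0 < 1 + m], which
    selects the positive square root. *)
Lemma mu_min_id (R : realType) (p : nat) (phi : R) : (0 < p)%N -> 0 < phi ->
  mu_min (1%:M : 'M[R]_p) phi = Num.sqrt phi - 1.
Proof.
move=> p0 phi0; have s0 : 0 < Num.sqrt phi by rewrite sqrtr_gt0.
apply: xget_unique => [|m]; rewrite /= /is_mu_min r_min_id// phi_tr2_id//.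
  split; first lra.
  rewrite addrC subrK exprVn sqr_sqrtr ?ltW// divff// gt_eqF//.
move=> [m1 /esym mE]; have m0 : 0 < 1 + m by lra.
have -> : phi = (1 + m) ^+ 2.
  by apply: divr1_eq; rewrite -exprVn.
by rewrite sqrtr_sqr gtr0_norm//; lra.
Qed.

(** The value is nonpositive, so every [lambda > 0] is an admissible penalty. *)
Lemma lambda_min_id (R : realType) (p : nat) (phi : R) : (0 < p)%N ->
  0 < phi -> lambda_min (1%:M : 'M[R]_p) phi = - (Num.sqrt phi - 1) ^+ 2.
Proof.
move=> p0 phi0; have s0 : 0 < Num.sqrt phi by rewrite sqrtr_gt0.
rewrite /lambda_min mu_min_id// phi_tr1_id// -{2}(sqr_sqrtr (ltW phi0)).
by field; rewrite addrC subrK gt_eqF.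
Qed.

(** * The fixed point as the positive root of a quadratic *)

(* The positive root of [m ^+ 2 + (1 - lambda - phi) * m - lambda], which is
   the fixed-point equation for [mu] cleared of its denominator. *)
Definition mu_root (R : realType) (lambda phi : R) : R :=
  (lambda + phi - 1 + Num.sqrt ((lambda + phi - 1) ^+ 2 + 4 * lambda)) / 2.

Lemma mu_root_gt0 (R : realType) (lambda phi : R) :
  0 < lambda -> 0 < mu_root lambda phi.
Proof.
move=> l0; rewrite /mu_root divr_gt0//.
have : `|lambda + phi - 1|
    < Num.sqrt ((lambda + phi - 1) ^+ 2 + 4 * lambda).
  rewrite -sqrtr_sqr ltr_sqrt; first lra.
  by have := sqr_ge0 (lambda + phi - 1); lra.
by move=> /ltr_normlP[]; lra.
Qed.

Lemma mu_root_eq (R : realType) (lambda phi : R) : 0 < lambda ->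
  let m := mu_root lambda phi in
  phi * m = (m - lambda) * (1 + m).
Proof.
move=> l0 /=; rewrite /mu_root.
have := @sqr_sqrtr _ ((lambda + phi - 1) ^+ 2 + 4 * lambda).
have := sqr_ge0 (lambda + phi - 1).
move: (Num.sqrt _) => s h /(_ ltac:(lra)) sE.
suff : s ^+ 2 - ((lambda + phi - 1) ^+ 2 + 4 * lambda) = 0 by nra.
by rewrite sE subrr.
Qed.

Lemma mu_root_gt (R : realType) (lambda phi : R) :
  0 < lambda -> 0 < phi -> lambda < mu_root lambda phi.
Proof.
move=> l0 phi0; have := mu_root_gt0 phi l0; have /= := mu_root_eq phi l0.
move: (mu_root _ _) => m mE m0.
have : 0 < (m - lambda) * (1 + m) by rewrite -mE mulr_gt0.
by rewrite pmulr_lgt0 ?subr_gt0//; lra.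
Qed.

(** The two roots of the quadratic have product [- lambda < 0], so only one is positive. *)
Lemma mu_root_unique (R : realType) (lambda phi m : R) : 0 < lambda ->
  0 < m -> phi * m = (m - lambda) * (1 + m) -> m = mu_root lambda phi.
Proof.
move=> l0 m0 mE; have := mu_root_gt0 phi l0; have /= := mu_root_eq phi l0.
move: (mu_root _ _) => n nE n0.
(* Eliminating [phi] leaves [(m - n) * (m * n + lambda) = 0]. *)
have /eqP : (m - n) * (m * n + lambda) = 0.
  have : n * (phi * m) = m * (phi * n) by ring.
  by rewrite mE nE; lra.
rewrite mulf_eq0 subr_eq0 => /orP[/eqP//|/eqP h].
by have := mulr_gt0 m0 n0; lra.
Qed.

Lemma mu_root_mono (R : realType) (lambda : R) : 0 < lambda ->
  {homo mu_root lambda : x y / x < y}.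
Proof.
move=> l0 x y xy; rewrite ltNge; apply/negP.
have := mu_root_gt0 x l0; have /= := mu_root_eq x l0.
have := mu_root_gt0 y l0; have /= := mu_root_eq y l0.
move: (mu_root _ x) (mu_root _ y) => m n nE n0 mE m0 nm.
have mn0 : 0 < m * n by exact: mulr_gt0.
have : (x - y) * (m * n) = (m - n) * (m * n + lambda).
  rewrite (_ : _ * _ = n * (x * m) - m * (y * n)); last by ring.
  by rewrite mE nE; ring.
have : 0 <= (m - n) * (m * n + lambda) by apply: mulr_ge0; lra.
have : 0 < (y - x) * (m * n) by apply: mulr_gt0; lra.
lra.
Qed.

Lemma mu_id (R : realType) (p : nat) (lambda phi : R) : (0 < p)%N ->
  0 < lambda -> 0 < phi ->
  mu (1%:M : 'M[R]_p) lambda phi = mu_root lambda phi.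
Proof.
move=> p0 l0 phi0; have s0 : 0 < Num.sqrt phi by rewrite sqrtr_gt0.
have sE := sqr_sqrtr (ltW phi0).
apply: xget_unique => [|m]; rewrite /= /is_mu lambda_min_id// mu_min_id//
  phi_tr1_id//.
  have := mu_root_gt0 phi l0; have /= := mu_root_eq phi l0.
  move: (mu_root _ _) => m mE m0; split.
  - by have := sqr_ge0 (Num.sqrt phi - 1); lra.
  (* Squaring turns [mu_min < m] into [phi < (1 + m) ^+ 2]; multiplying by [m] then allows [phi * m]
     to be eliminated. *)
  - rewrite ltrBlDl -(@ltr_pXn2r _ 2) ?nnegrE ?sE//; try lra.
    rewrite -(ltr_pM2r m0) mE -subr_gt0.
    rewrite (_ : _ - _ = (1 + m) * (m ^+ 2 + lambda)); last by ring.
    by rewrite mulr_gt0//; nra.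
  - by rewrite mulrA mE mulfK; [ring|rewrite gt_eqF//; lra].
move=> [_ mm mE]; have m1 : 0 < 1 + m by lra.
have {}mE : phi * m = (m - lambda) * (1 + m).
  have -> : m - lambda = phi * (m * (1 + m)^-1) by lra.
  by field; rewrite gt_eqF.
(* The cutoff [mu_min < m] is what discards the negative root: if [m <= 0], this bound gives
   [m * (1 + m) ^+ 2 <= phi * m], contradicting the fixed-point equation. *)
have phim : phi < (1 + m) ^+ 2 by nra.
apply: mu_root_unique => //; rewrite ltNge; apply/negP => m0.
have : (m - lambda) * (1 + m) < m * (1 + m) ^+ 2 by nra.
by nra.
Qed.

(** * Closed forms of variance and bias in terms of the fixed point *)

Lemma vtilde_id (R : realType) (p : nat) (lambda phi : R) : (0 < p)%N ->
  0 < lambda -> 0 < phi ->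
  let m := mu_root lambda phi in
  vtilde (1%:M : 'M[R]_p) 1%:M lambda phi = (m - lambda) / (m ^+ 2 + lambda).
Proof.
move=> p0 l0 phi0 /=.
rewrite /vtilde phi_tr2_id// mu_id//.
have := mu_root_gt0 phi l0; have /= := mu_root_eq phi l0.
move: (mu_root _ _) => m mE m0.
have -> : phi = (m - lambda) * (1 + m) / m by rewrite -mE mulfK ?gt_eqF.
have d0 := sqrD_gt0 m l0.
have n0 : 1 - (m - lambda) * (1 + m) / m * (1 + m)^-1 ^+ 2
    = (m ^+ 2 + lambda) / (m * (1 + m)).
  by field; apply/andP; split; rewrite gt_eqF//; lra.
rewrite n0; field; do ?[apply/andP; split]; rewrite gt_eqF//; lra.
Qed.

(** The middle factor is the scalar [vtilde + 1 = m * (1 + m) / (m ^+ 2 + lambda)], which cancels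
    one of the two resolvents. *)
Lemma risk_bias_id (R : realType) (p : nat) (beta : 'cV[R]_p)
    (lambda phi : R) : (0 < p)%N -> 0 < lambda -> 0 < phi ->
  let m := mu_root lambda phi in
  risk_bias 1%:M 1%:M beta lambda phi
  = sqnorm beta * (m ^+ 3 / ((1 + m) * (m ^+ 2 + lambda))).
Proof.
move=> p0 l0 phi0 /=; rewrite /risk_bias vtilde_id// mu_id// resolvent_id.
rewrite scale_scalar_mx mulr1 -raddfD/= -!scalar_mxM quad_scalar.
have := mu_root_gt0 phi l0; move: (mu_root _ _) => m m0.
have d0 := sqrD_gt0 m l0.
by field; do ?[apply/andP; split]; rewrite gt_eqF//; lra.
Qed.

(** * Monotonicity of the profiles and the threshold in [phi] *)

Lemma bias_profile_mono (R : realType) (lambda x y : R) : 0 < lambda ->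
  0 < x -> x < y ->
  x ^+ 3 / ((1 + x) * (x ^+ 2 + lambda))
  < y ^+ 3 / ((1 + y) * (y ^+ 2 + lambda)).
Proof.
move=> l0 x0 xy; have y0 := lt_trans x0 xy.
have dx : 0 < (1 + x) * (x ^+ 2 + lambda) by apply: mulr_gt0; nra.
have dy : 0 < (1 + y) * (y ^+ 2 + lambda) by apply: mulr_gt0; nra.
rewrite ltr_pdivrMr// mulrAC ltr_pdivlMr// -subr_gt0.
(* After cross-multiplication, [y - x] factors out and leaves a polynomial with positive
   coefficients. *)
rewrite (_ : _ - _ = (y - x) * (x ^+ 2 * y ^+ 2
  + lambda * (x ^+ 2 + x * y + y ^+ 2) + lambda * (x * y) * (x + y)));
  last by ring.
rewrite mulr_gt0 ?subr_gt0//.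
by rewrite !addr_gt0 ?mulr_gt0 ?addr_gt0 ?mulr_gt0 ?exprn_gt0.
Qed.

Lemma variance_profile_sub (R : realType) (lambda x y : R) : 0 < lambda ->
  (y - lambda) / (y ^+ 2 + lambda) - (x - lambda) / (x ^+ 2 + lambda)
  = (y - x) * (lambda ^+ 2 + lambda - (x - lambda) * (y - lambda))
    / ((x ^+ 2 + lambda) * (y ^+ 2 + lambda)).
Proof.
move=> l0; have := sqr_ge0 x; have := sqr_ge0 y => ??.
by field; apply/andP; split; rewrite gt_eqF//; lra.
Qed.

(** The fixed-point equation rearranges to [(phi - lambda - 1) * m = (m - lambda) ^+ 2 - (lambda ^+
    2 + lambda)] with [m > 0], so both sides change sign at [phi = lambda + 1]. *)
Lemma mu_root_small (R : realType) (lambda phi : R) : 0 < lambda ->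
  phi < lambda + 1 ->
  (mu_root lambda phi - lambda) ^+ 2 < lambda ^+ 2 + lambda.
Proof.
move=> l0 pl; have := mu_root_gt0 phi l0; have /= := mu_root_eq phi l0.
by move: (mu_root _ _) => m mE m0; nra.
Qed.

Lemma mu_root_large (R : realType) (lambda phi : R) : 0 < lambda ->
  lambda + 1 < phi ->
  lambda ^+ 2 + lambda < (mu_root lambda phi - lambda) ^+ 2.
Proof.
move=> l0 pl; have := mu_root_gt0 phi l0; have /= := mu_root_eq phi l0.
by move: (mu_root _ _) => m mE m0; nra.
Qed.

(** * Derivatives in [phi] and in the fixed point *)

Lemma is_derive_mu_root (R : realType) (lambda phi : R) : 0 < lambda ->
  is_derive phi 1 (mu_root lambda)
    (mu_root lambda phi / Num.sqrt ((lambda + phi - 1) ^+ 2 + 4 * lambda)).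
Proof.
move=> l0; set D := fun t : R => (lambda + t - 1) ^+ 2 + 4 * lambda.
have D0 : 0 < D phi by rewrite sqrD_gt0// mulr_gt0.
have dD : is_derive phi 1 D (2 * (lambda + phi - 1)).
  by apply: is_derive_eq; rewrite /GRing.scale/=; ring.
have dS := is_derive1_comp (is_derive1_sqrt D0) dD.
have s0 : Num.sqrt (D phi) != 0 by rewrite gt_eqF// sqrtr_gt0.
rewrite [mu_root lambda phi]/mu_root -/(D phi).
have -> : mu_root lambda = 2^-1 \*: ((cst (lambda - 1) + id) + (Num.sqrt \o D)).
  by apply/funext => t; rewrite !fctE /mu_root /D /= /GRing.scale/=; field.
by apply: is_derive_eq; rewrite /GRing.scale/=; field.
Qed.

(** The numerator is the factor found in [variance_profile_sub], taken on the diagonal;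
    [mu_root_large] makes it negative. *)
Lemma is_derive_variance_profile (R : realType) (lambda m : R) : 0 < lambda ->
  is_derive m 1 (fun t : R => (t - lambda) / (t ^+ 2 + lambda))
    ((lambda ^+ 2 + lambda - (m - lambda) ^+ 2) / (m ^+ 2 + lambda) ^+ 2).
Proof.
move=> l0; have d0 : m ^+ 2 + lambda != 0 by rewrite gt_eqF// sqrD_gt0.
have dN : is_derive m 1 (fun t : R => t - lambda) 1.
  by apply: is_derive_eq; rewrite subr0.
have dD : is_derive m 1 (fun t : R => t ^+ 2 + lambda) (2 * m).
  by apply: is_derive_eq; rewrite /GRing.scale/=; ring.
have dV := @is_deriveV _ (fun t : R => t ^+ 2 + lambda) _ _ _ d0 dD.
apply: is_derive_eq (is_deriveM dN dV) _.
by rewrite /GRing.scale/=; field.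
Qed.

(** Existence of the derivative suffices, since the choice of [sigma2] absorbs its value. *)
Lemma derivable_bias_profile (R : realType) (lambda m : R) : 0 < lambda ->
  0 < m ->
  derivable (fun t : R => t ^+ 3 / ((1 + t) * (t ^+ 2 + lambda))) m 1.
Proof.
move=> l0 m0; apply: derivableM; first exact: ex_derive.
apply: derivableV; last exact: ex_derive.
by rewrite gt_eqF// mulr_gt0//; nra.
Qed.

Lemma risk_id (R : realType) (p : nat) (beta : 'cV[R]_p)
    (sigma2 sigma02 lambda phi : R) : (0 < p)%N -> 0 < lambda -> 0 < phi ->
  let m := mu_root lambda phi in
  risk 1%:M 1%:M beta beta sigma2 sigma02 lambda phi
  = sqnorm beta * (m ^+ 3 / ((1 + m) * (m ^+ 2 + lambda)))
    + sigma2 * ((m - lambda) / (m ^+ 2 + lambda)) + sigma02.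
Proof.
move=> p0 l0 phi0 /=; rewrite /risk risk_bias_id//.
rewrite /risk_variance vtilde_id// /risk_shift /irreducible_error subrr.
by rewrite /quad !mulmx0 mxE mulr0 add0r addr0.
Qed.

Theorem theorem5 (R : realType) (p : nat) (hp : (0 < p)%N)
    (Sigma Sigma0 : 'M[R]_p) (beta beta0 : 'cV[R]_p) (sigma02 : R)
    (hsigma02 : 0 <= sigma02)
    (hshift : (Sigma0, beta0) = (Sigma, beta))
    (hSigma : Sigma = 1%:M) :
  [/\ (0 < sqnorm beta ->
       forall lambda : R, 0 < lambda ->
       increasing_on `]0, +oo[ (risk_bias Sigma Sigma0 beta lambda)),
      (forall sigma2 : R, 0 < sigma2 ->
       forall lambda : R, 0 < lambda ->
       increasing_on `]0, (lambda + 1)[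
         (risk_variance Sigma Sigma0 sigma2 lambda) /\
       decreasing_on `](lambda + 1), +oo[
         (risk_variance Sigma Sigma0 sigma2 lambda))
    & (0 < sqnorm beta ->
       forall lambda : R, 0 < lambda -> forall eps : R, 0 < eps ->
       exists sigma2 phi : R,
         [/\ 0 < sigma2, 0 < phi,
             derivable
               (risk Sigma Sigma0 beta beta0 sigma2 sigma02 lambda) phi 1
           & derive1
               (risk Sigma Sigma0 beta beta0 sigma2 sigma02 lambda) phi
             <= - eps])].
Proof.
case: hshift => -> ->; rewrite hSigma; split.
- move=> b0 lambda l0 x y; rewrite !in_itv/= !andbT => x0 y0 xy.
  rewrite !risk_bias_id// ltr_pM2l//.
  by apply: bias_profile_mono; rewrite ?mu_root_gt0//; exact: mu_root_mono.
- move=> sigma2 s0 lambda l0; split=> x y; rewrite !in_itv/= ?andbT.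
  + move=> /andP[x0 xl] /andP[y0 yl] xy.
    rewrite /risk_variance ltr_pM2l// !vtilde_id// -subr_gt0.
    rewrite variance_profile_sub//.
    have mxy := mu_root_mono l0 xy; have my := mu_root_small l0 yl.
    have mx := mu_root_gt l0 x0.
    apply: divr_gt0; last by rewrite mulr_gt0// sqrD_gt0.
    (* Both roots exceed [lambda], so the mixed product is at most the square for the larger root,
       at [y]. *)
    rewrite mulr_gt0 ?subr_gt0//; apply: le_lt_trans my.
    by rewrite expr2 ler_pM2r; lra.
  + move=> xl yl yx; have x0 : 0 < x by lra.
    have y0 : 0 < y by lra.
    rewrite /risk_variance ltr_pM2l// !vtilde_id// -subr_gt0.
    rewrite variance_profile_sub//.
    have mxy := mu_root_mono l0 yx; have my := mu_root_large l0 yl.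
    have mx := mu_root_gt l0 y0.
    apply: divr_gt0; last by rewrite mulr_gt0// sqrD_gt0.
    (* Here the smaller root, at [y], bounds the mixed product from below by its square. *)
    rewrite nmulr_rgt0 ?subr_lt0//; apply: lt_le_trans my _.
    by rewrite expr2 ler_pM2r; lra.
- move=> b0 lambda l0 eps e0.
  (* A point beyond the threshold [lambda + 1], where the variance has negative slope. *)
  pose phi := lambda + 2; have phi0 : 0 < phi by rewrite /phi; lra.
  pose m := mu_root lambda phi; have m0 : 0 < m by exact: mu_root_gt0.
  have := is_derive_mu_root phi l0; set M' := (X in is_derive _ _ _ X) => dM.
  have M'0 : 0 < M'.
    by rewrite divr_gt0// sqrtr_gt0 sqrD_gt0// mulr_gt0.
  have dv := is_derive1_comp (is_derive_variance_profile m l0) dM.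
  have db := is_derive1_comp (derivableP (derivable_bias_profile l0 m0)) dM.
  move: dv db; set V' := (X in is_derive _ _ _ X -> _).
  set B' := (X in _ -> is_derive _ _ _ X -> _) => dv db.
  have V'0 : V' < 0.
    rewrite /V' pmulr_llt0// pmulr_llt0 ?subr_lt0; last first.
      by rewrite invr_gt0 exprn_gt0// addr_gt0// exprn_gt0.
    by apply: mu_root_large => //; rewrite /phi; lra.
  (* Chosen so that [sigma2 * V' = - (eps + |sqnorm beta * B'|)]: this cancels the slope of the bias
     and leaves at most [- eps]. *)
  pose sigma2 := (eps + `|sqnorm beta * B'|) / - V'.
  have s0 : 0 < sigma2.
    by rewrite divr_gt0 ?oppr_gt0// ltr_wpDr.
  have dR : is_derive phi 1
      (risk (1%:M : 'M[R]_p) 1%:M beta beta sigma2 sigma02 lambda)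
      (sqnorm beta * B' + sigma2 * V').
    have := is_deriveD (is_deriveD (is_deriveZ (sqnorm beta) db)
      (is_deriveZ sigma2 dv)) (is_derive_cst sigma02 phi 1).
    (* The closed form of the risk is available for positive arguments, hence on a neighbourhood of
       [phi], which determines the derivative. *)
    rewrite addr0; apply: near_eq_is_derive.
    near=> t; rewrite risk_id//.
    by near: t; exact: lt_nbhsr.
  exists sigma2, phi; split => //; rewrite derive1E derive_val.
  rewrite (_ : sigma2 * V' = - (eps + `|sqnorm beta * B'|)); last first.
    by rewrite /sigma2; field; rewrite lt_eqF.
  by have := ler_norm (sqnorm beta * B'); lra.
Unshelve. all: by end_near. Qed.
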